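(* (i) An ordered set $P=\langle P;\leq\rangle$ is isomorphic to $\mathrm{Princ}(L)$ for some countable lattice $L$ if and only if $P$ is a countable directed ordered set with zero. (ii) If $P$ is an ordered set with zero and it is the union of a chain of principal ideals, then there exists a lattice $L$ such that $P\cong \mathrm{Princ}(L)$.
   Context: An ordered set is a nonempty set equipped with a reflexive, transitive, antisymmetric relation (a poset). ''With zero'' means having a least element. For a lattice $L$ and $a,b\in L$, $\mathrm{con}(a,b)$ is the least lattice congruence of $L$ collapsing $a$ and $b$; congruences of this form are called principal. $\mathrm{Princ}(L)=\langle \mathrm{Princ}(L);\subseteq\rangle$ is the set of all principal congruences of $L$ ordered by inclusion. A set $X$ is countable if it is finite or countably infinite, i.e. $|X|\leq\aleph_0$. An ordered set $P$ is directed if each two-element subset of $P$ has an upper bound in $P$. A principal ideal of $P$ is a subset of the form $\mathord{\downarrow} c=\{x\in P: x\leq c\}$ with $c\in P$; a chain of principal ideals is a set of principal ideals that is linearly ordered by inclusion. Isomorphism ($\cong$) is order isomorphism. *)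

(* Defs.v *)
From HB Require Import structures.
From mathcomp Require Import all_boot all_order.
From mathcomp Require Import boolp classical_sets functions cardinality.

Set Implicit Arguments.
Unset Strict Implicit.
Unset Printing Implicit Defensive.

Import Order.Theory.

Local Open Scope order_scope.
Local Open Scope classical_set_scope.

Section Congruences.
Context {d : Order.disp_t} {L : latticeType d}.

(* A binary relation on [L] is identified with its graph, so that inclusion of
   congruences is the inclusion [`<=`] of sets. *)
Record is_congruence (theta : set (L * L)) : Prop := IsCongruence {
  cong_refl : forall x, theta (x, x);
  cong_sym : forall x y, theta (x, y) -> theta (y, x);
  cong_trans : forall x y z, theta (x, y) -> theta (y, z) -> theta (x, z);
  cong_meet : forall x x' y y',
    theta (x, x') -> theta (y, y') -> theta ((x `&` y)%O, (x' `&` y')%O);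
  cong_join : forall x x' y y',
    theta (x, x') -> theta (y, y') -> theta ((x `|` y)%O, (x' `|` y')%O)
}.

Definition con (a b : L) : set (L * L) := smallest is_congruence [set (a, b)].

Lemma con_congruence a b : is_congruence (con a b).
Proof.
split.
- by move=> x theta [] /cong_refl.
- by move=> x y xy theta th; apply: (cong_sym th.1); apply: xy.
- move=> x y z xy yz theta th.
  by apply: (cong_trans th.1 (y := y)); [apply: xy|apply: yz].
- move=> x x' y y' xx' yy' theta th.
  by apply: (cong_meet th.1); [apply: xx'|apply: yy'].
- move=> x x' y y' xx' yy' theta th.
  by apply: (cong_join th.1); [apply: xx'|apply: yy'].
Qed.

Lemma con_collapses a b : con a b (a, b).
Proof. exact: sub_gen_smallest. Qed.

Lemma con_least a b theta :
  is_congruence theta -> theta (a, b) -> con a b `<=` theta.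
Proof. by move=> Hth ab; apply: smallest_sub => // _ ->. Qed.

End Congruences.

Definition Princ {d : Order.disp_t} (L : latticeType d) : set (set (L * L)) :=
  [set theta | exists a b : L, theta = con a b].
Arguments Princ {d} L.

Definition iso_Princ {d d' : Order.disp_t}
    (P : porderType d) (L : latticeType d') : Prop :=
  exists2 f : P -> set (L * L), set_bij [set: P] (Princ L) f &
    forall x y : P, x <= y <-> f x `<=` f y.

Section OrderedSets.
Context {d : Order.disp_t} (P : porderType d).

Definition has_zero : Prop := exists z : P, forall x : P, z <= x.

Definition directed : Prop :=
  forall x y : P, x <> y -> exists z : P, x <= z /\ y <= z.

Definition is_principal_ideal (I : set P) : Prop :=
  exists c : P, I = [set x | x <= c].

Definition is_chain_of_principal_ideals (C : set (set P)) : Prop :=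
  (forall I, C I -> is_principal_ideal I) /\
  total_on C (fun I J => I `<=` J).

End OrderedSets.

(* Main.v *)
(** The converse direction of (i) is easy: con(a,b) and con(a',b') lie below
    con(m,j), where m and j are the meet and the join of the four elements.

    For the existence of [L], both hypotheses give a cofinal well-ordered subset
    [D] of P \ {0}.  The lattice has nested intervals [0_c, 1_c] (c in D), growing
    with c, and inside [0_c, 1_c] a two-element interval a_(p,c) < b_(p,c) for
    each 0 < p < c; the convention a_(c,c) = 0_c, b_(c,c) = 1_c makes the nested
    intervals themselves intervals of colour c.  Two things must happen:
    if p <= q then collapsing any interval of colour q collapses all those of
    colour p, and any two elements that are not separated by intervals of
    pairwise comparable colours must generate some con(0_c, 1_c).

    The lattice is obtained as a lattice of sets: fix the points 0_c, 1_c,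
    a_(p,c), b_(p,c) and three further points per level, and take the suitably
    finite sets of points closed under binary implications, notably
    a_(p,c), b_(q,e) => b_(p,c) for p <= q, and "two incompatible points of level
    at most c imply 1_c".  Meets are intersections and joins are closures of
    unions, so no lattice identity has to be checked.  For r in P, adding the
    implications a_(p,c) => b_(p,c) (p <= r) and 0_c => 1_c (c <= r) gives a
    coarser closure operator; it preserves intersections of closed sets, so its
    kernel is a congruence, and it collapses an interval of colour p iff p <= r.
    Finally, if x < y then the colours of the intervals a_(p,c) in x, b_(p,c) not
    in x form a chain; finitely many of them account for all points of y outside
    x, and con(x,y) is the principal congruence of the largest one. *)

Require Import Defs.
From HB Require Import structures.
From mathcomp Require Import all_boot all_order.
From mathcomp Require Import boolp classical_sets functions cardinality wochoice.

Set Implicit Arguments.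
Unset Strict Implicit.
Unset Printing Implicit Defensive.

Import Order.Theory.

Local Open Scope order_scope.
Local Open Scope classical_set_scope.

(** * Principal congruences in an arbitrary lattice *)

Section LatticeCongruences.
Context {d : Order.disp_t} {L : latticeType d}.
Implicit Types (x y z : L) (th : set (L * L)).

Lemma cong_meetl th z x y : is_congruence th ->
  th (x, y) -> th ((z `&` x)%O, (z `&` y)%O).
Proof. by move=> hth h; apply: (cong_meet hth) h; apply: (cong_refl hth). Qed.

Lemma cong_joinl th z x y : is_congruence th ->
  th (x, y) -> th ((z `|` x)%O, (z `|` y)%O).
Proof. by move=> hth h; apply: (cong_join hth) h; apply: (cong_refl hth). Qed.

Lemma cong_between th x y z : is_congruence th ->
  (x <= z)%O -> (z <= y)%O -> th (x, y) -> th (x, z).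
Proof.
move=> hth xz zy /(cong_meetl z hth).
by rewrite meetC (meet_idPl xz) (meet_idPl zy).
Qed.

Lemma con_refl_sub x th : is_congruence th -> con x x `<=` th.
Proof. by move=> hth; apply: con_least => //; apply: cong_refl hth _. Qed.

(** Reduces the classification to comparable pairs. Both elements lie between their meet and join;
    conversely, meeting and joining the pair with [y] links the meet and the join through [y]. *)
Lemma con_meet_join x y : con x y = con (x `&` y)%O (x `|` y)%O.
Proof.
have h1 := con_congruence x y.
have h2 := con_congruence (x `&` y)%O (x `|` y)%O.
have xy := @con_collapses _ _ x y.
have mj := @con_collapses _ _ (x `&` y)%O (x `|` y)%O.
apply/seteqP; split; apply: con_least => //.
  apply: (cong_trans h2 (y := (x `&` y)%O)); first apply: (cong_sym h2).
    by apply: (cong_between h2) mj; [exact: leIl|exact: leUl].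
  by apply: (cong_between h2) mj; [exact: leIr|exact: leUr].
apply: (cong_trans h1 (y := y)).
  by have := cong_meet h1 xy (cong_refl h1 y); rewrite meetxx.
by apply: (cong_sym h1); have := cong_join h1 xy (cong_refl h1 y); rewrite joinxx.
Qed.

Lemma con_le_con a b x y :
  (x <= a <= y)%O -> (x <= b <= y)%O -> con a b `<=` con x y.
Proof.
move=> /andP[xa ay] /andP[xb yb]; have h := con_congruence x y.
have xy := @con_collapses _ _ x y.
apply: con_least => //; apply: (cong_trans h (y := x)); first apply: (cong_sym h);
by apply: (cong_between h) xy.
Qed.

End LatticeCongruences.

(* [lev] is the well-ordered cofinal set D of levels; [kap p] is the least level
   above [p]. *)
Record frame (d : Order.disp_t) (P : porderType d) := Frame {
  bot : P;
  bot_le : forall p, bot <= p;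
  lev : set P;
  lev_neq0 : forall c, lev c -> c <> bot;
  lev_min : forall E : set P, E `<=` lev -> E !=set0 ->
    exists2 m, E m & forall e, E e -> m <= e;
  kap : P -> P;
  kap_lev : forall p, lev (kap p);
  kap_ge : forall p, p <= kap p;
  kap_least : forall p c, lev c -> p <= c -> kap p <= c
}.

(* [Lo p c] and [Hi p c] are a_(p,c) and b_(p,c); in particular [Lo c c] is 0_c
   and [Hi c c] is 1_c.  The atoms [Dum c i] of [0_c, 1_c] form an M_3 with 0_c
   and 1_c, which forces every congruence joining 0_c to a larger element of
   [0_c, 1_c] to collapse the whole interval. *)
Inductive pt (P : Type) : Type :=
  | Lo of P & P
  | Hi of P & P
  | Dum of P & option bool.

Arguments Dum {P} c i.

HB.instance Definition _ (P : Type) := gen_eqMixin (pt P).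
HB.instance Definition _ (P : Type) := gen_choiceMixin (pt P).

(** * Levels, points and closure rules *)

Section Points.
Context {d : Order.disp_t} {P : porderType d} (F : frame P).
Implicit Types (p q r c e f m : P) (s t : pt P) (T U J : set (pt P)).

Definition lv s := match s with Lo _ c | Hi _ c | Dum c _ => c end.
Definition col s := match s with Lo p _ | Hi p _ => p | Dum c _ => c end.

(** Colour [bot] is excluded because the zero of [P] has to correspond to the trivial congruence. *)
Definition valid s :=
  [/\ lev F (lv s), col s <> bot F & col s <= lv s].

Lemma lev_total c e : lev F c -> lev F e -> c <= e \/ e < c.
Proof.
have ne : [set c; e] !=set0 by exists c; left.
move=> hc he; have [|m mE hm] := lev_min (f := F) _ ne.
- by move=> x [->|->].
case: mE hm => -> hm; first by left; apply: hm; right.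
have : e <= c by apply: hm; left.
by rewrite le_eqVlt => /orP[/eqP->|]; [left|right].
Qed.

Lemma lev_valid c : lev F c -> valid (Lo c c) /\ valid (Hi c c).
Proof. by move=> hc; have := lev_neq0 hc; split; split. Qed.

Lemma kap_id c : lev F c -> kap F c = c.
Proof. by move=> hc; apply/le_anti; rewrite kap_ge kap_least. Qed.

(* [cl_low] is why levels are well ordered: a_(p,c) joined with 0_e, e < kap p,
   must lie below its join with 1_(kap p), because any congruence of colour at
   least kap p identifies 0_e with 0_(kap p). *)
Record closed T : Prop := Closed {
  cl_valid : forall s, T s -> valid s;
  cl_lo : forall s, T s -> T (Lo (lv s) (lv s));
  cl_up : forall e f, T (Lo e e) -> lev F f -> e <= f -> T (Lo f f);
  cl_one : forall c s, T (Hi c c) -> valid s -> lv s <= c -> T s;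
  cl_hi : forall p c, T (Hi p c) -> T (Lo p c);
  cl_arrow : forall p c q e, T (Lo p c) -> T (Hi q e) -> p <= q -> T (Hi p c);
  cl_dum : forall c i s, T (Dum c i) -> T s -> s <> Dum c i -> s <> Lo c c ->
    lv s <= c -> T (Hi c c);
  cl_incomp : forall p q c, T (Lo p c) -> T (Lo q c) ->
    ~ p <= q -> ~ q <= p -> T (Hi c c);
  cl_low : forall p c e, T (Lo p c) -> p <> c -> T (Lo e e) -> e < kap F p ->
    T (Hi (kap F p) (kap F p));
  cl_cross : forall p c q e, T (Lo p c) -> p <> c -> T (Lo q e) ->
    kap F p <= e -> e < c -> q <> e -> q <> p -> T (Hi e e);
  cl_cross_dum : forall p c e i, T (Lo p c) -> p <> c -> T (Dum e i) ->
    kap F p <= e -> e < c -> T (Hi e e)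
}.

Lemma closed_valid : closed valid.
Proof.
have one c s : valid s -> lv s = c -> valid (Hi c c).
  by move=> [h _ _] <-; have [] := lev_valid h.
split=> //.
- by move=> s [h _ _]; have [] := lev_valid h.
- by move=> e f _ hf _; have [] := lev_valid hf.
- by move=> p q c h _ _ _; apply: one h _.
- by move=> p c e _ _ _ _; have [] := lev_valid (kap_lev F p).
- by move=> p c q e _ _ h _ _ _ _; apply: one h _.
Qed.

Lemma closedI T U : closed T -> closed U -> closed (T `&` U).
Proof.
move=> hT hU; split.
- by move=> s [/(cl_valid hT)].
- by move=> s [/(cl_lo hT) ? /(cl_lo hU)].
- by move=> e f [a b] ? ?; split; [apply: (cl_up hT) a _ _|apply: (cl_up hU) b _ _].
- by move=> c s [a b] ? ?; split; [apply: (cl_one hT) a _ _|apply: (cl_one hU) b _ _].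
- by move=> p c [/(cl_hi hT) ? /(cl_hi hU)].
- move=> p c q e [a b] [a' b'] ?.
  by split; [apply: (cl_arrow hT) a a' _|apply: (cl_arrow hU) b b' _].
- move=> c i s [a b] [a' b'] ? ? ?.
  by split; [apply: (cl_dum hT) a a' _ _ _|apply: (cl_dum hU) b b' _ _ _].
- move=> p q c [a b] [a' b'] ? ?.
  by split; [apply: (cl_incomp hT) a a' _ _|apply: (cl_incomp hU) b b' _ _].
- move=> p c e [a b] ? [a' b'] ?.
  by split; [apply: (cl_low hT) a _ a' _|apply: (cl_low hU) b _ b' _].
- move=> p c q e [a b] ? [a' b'] ? ? ? ?.
  by split; [apply: (cl_cross hT) a _ a' _ _ _ _|apply: (cl_cross hU) b _ b' _ _ _ _].
- move=> p c e i [a b] ? [a' b'] ? ?.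
  by split; [apply: (cl_cross_dum hT) a _ a' _ _|apply: (cl_cross_dum hU) b _ b' _ _].
Qed.

Definition cl T : set (pt P) := smallest closed T.

Lemma sub_cl T : T `<=` cl T.
Proof. exact: sub_smallest. Qed.

Lemma cl_sub T U : closed U -> T `<=` U -> cl T `<=` U.
Proof. by move=> hU TU s; apply. Qed.

Lemma cl_closed T : T `<=` valid -> closed (cl T).
Proof.
move=> hT; split.
- by move=> s /(_ valid (conj closed_valid hT)).
- by move=> s h U hU; apply: (cl_lo hU.1); apply: h.
- by move=> e f h ? ? U hU; apply: (cl_up hU.1) (h _ hU) _ _.
- by move=> c s h ? ? U hU; apply: (cl_one hU.1) (h _ hU) _ _.
- by move=> p c h U hU; apply: (cl_hi hU.1) (h _ hU).
- by move=> p c q e a b ? U hU; apply: (cl_arrow hU.1) (a _ hU) (b _ hU) _.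
- by move=> c i s a b ? ? ? U hU; apply: (cl_dum hU.1) (a _ hU) (b _ hU) _ _ _.
- by move=> p q c a b ? ? U hU; apply: (cl_incomp hU.1) (a _ hU) (b _ hU) _ _.
- by move=> p c e a ? b ? U hU; apply: (cl_low hU.1) (a _ hU) _ (b _ hU) _.
- by move=> p c q e a ? b ? ? ? ? U hU;
    apply: (cl_cross hU.1) (a _ hU) _ (b _ hU) _ _ _ _.
- by move=> p c e i a ? b ? ? U hU;
    apply: (cl_cross_dum hU.1) (a _ hU) _ (b _ hU) _ _.
Qed.

(** * Finitary sets of points *)

Definition is_zero s := exists c, s = Lo c c.

(** Closed sets may be infinite for two reasons only: [cl_up] adds every later 0_f, and [cl_one]
    adds all points of level at most [M] once 1_M is present. A finite list accounts for the
    rest. *)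
Definition finitary T := exists X : seq (pt P), forall s, T s ->
  [\/ is_zero s, s \in X |
      exists M, [/\ Hi M M \in X, T (Hi M M) & lv s <= M]].

Lemma finitaryI T U : closed T -> closed U -> finitary T -> finitary U ->
  finitary (T `&` U).
Proof.
move=> hT hU [X hX] [Y hY]; exists (X ++ Y) => s [Ts Us].
have [?|sX|[M [MX MT sM]]] := hX s Ts; first exact: Or31.
  by apply: Or32; rewrite mem_cat sX.
have [?|sY|[N [NY NU sN]]] := hY s Us; first exact: Or31.
  by apply: Or32; rewrite mem_cat sY orbT.
apply: Or33.
have vM := cl_valid hT MT; have vN := cl_valid hU NU.
have [hM _ _] := vM; have [hN _ _] := vN.
(* By [cl_one], the top of the smaller level belongs to both sets. *)
have [MN|NM] := lev_total hM hN.
- by exists M; split; rewrite ?mem_cat ?MX//; split=> //; apply: (cl_one hU) NU _ _.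
- exists N; split; rewrite ?mem_cat ?NY ?orbT//; split=> //.
  by apply: (cl_one hT) MT _ _ => //; apply: ltW.
Qed.

Lemma cl_zero_max T e f : closed T -> T (Lo e e) -> lev F f -> T (Lo f f) \/ f < e.
Proof.
move=> hT Te hf; have [/= he _ _] := cl_valid hT Te.
by have [ef|] := lev_total he hf; [left; apply: (cl_up hT) Te _ _|right].
Qed.


(* This is T closed under the extra implications a_(p,c) => b_(p,c) (p <= r) and
   0_c => 1_c (c <= r); one step suffices, see [collapse_closed]. *)
Definition collapse r T : set (pt P) := fun s =>
  [\/ T s,
      exists p c, [/\ s = Hi p c, T (Lo p c) & p <= r] |
      [/\ valid s, lv s <= r & exists2 e, T (Lo e e) & e <= r]].

(** * The closure operators [collapse r] *)

Section Collapse.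
Variables (r : P) (T : set (pt P)).
Hypothesis hT : closed T.

(** On levels at most [r] the collapse is all or nothing: any point there is backed by some 0_e in
    [T] with e <= r, which brings in all the others ([collapse_low]). On other levels only tops of
    intervals are added ([collapse_high]). Each closure rule is checked along this split. *)
Lemma collapse_active s : collapse r T s -> lv s <= r ->
  exists2 e, T (Lo e e) & e <= r.
Proof.
case=> [Ts|[p [c [-> Ts _]]]|[_ _ h]] sr //.
- by exists (lv s) => //; apply: (cl_lo hT).
- by exists c => //; apply: (cl_lo hT Ts).
Qed.

Lemma collapse_low s t : collapse r T s -> lv s <= r -> valid t -> lv t <= r ->
  collapse r T t.
Proof. by move=> /collapse_active h /h h' vt tr; apply: Or33. Qed.

Lemma collapse_high s : collapse r T s -> ~ lv s <= r ->
  T s \/ exists p c, [/\ s = Hi p c, T (Lo p c) & p <= r].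
Proof. by move=> [Ts|h|[]//] _; [left|right]. Qed.

Lemma collapse_Lo p c : collapse r T (Lo p c) -> ~ c <= r -> T (Lo p c).
Proof. by move=> h nc; have [//|[? [? []//]]] := collapse_high h nc. Qed.

Lemma collapse_closed : closed (collapse r T).
Proof.
have vT := cl_valid hT.
have vR s : collapse r T s -> valid s.
  by case=> [/vT//|[p [c [-> /vT//]]]|[]//].
have vone s : collapse r T s -> valid (Hi (lv s) (lv s)).
  by move=> /vR[h _ _]; have [] := lev_valid h.
split=> //.
- move=> s h; have [hs _ _] := vR _ h; have [vL _] := lev_valid hs.
  case: h => [/(cl_lo hT) ?|[p [c [-> /(cl_lo hT) ? _]]]|[_ sr h]].
  + exact: Or31.
  + exact: Or31.
  + exact: Or33.
- move=> e f h hf ef; have [/= he _ _] := vR _ h; have [vL _] := lev_valid hf.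
  case: h => [h|[? [? []//]]|[_ er [e' h e'r]]].
    by apply: Or31; apply: (cl_up hT) h _ _.
  have [Tf|fe'] := cl_zero_max hT h hf; first exact: Or31.
  by apply: Or33; split=> //; [exact: le_trans (ltW fe') e'r|exists e'].
- move=> c s h vs sc.
  have [cr|ncr] := pselect (c <= r).
    by apply: (collapse_low h cr vs (le_trans sc cr)).
  have [Tc|[p [c' [[e1 _] _ pr]]]] := collapse_high h ncr.
    by apply: Or31; apply: (cl_one hT) Tc _ _.
  by case: ncr; rewrite e1.
- move=> p c h; have [cr|ncr] := pselect (c <= r).
    by exact: (collapse_low (t := Lo p c) h cr (vR _ h) cr).
  have [Tc|[p' [c' [[-> ->] Tc pr]]]] := collapse_high h ncr; apply: Or31 => //.
  exact: (cl_hi hT).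
- move=> p c q e h1 h2 pq; have [cr|ncr] := pselect (c <= r).
    by exact: (collapse_low (t := Hi p c) h1 cr (vR _ h1) cr).
  have T1 := collapse_Lo h1 ncr.
  case: h2 => [T2|[q' [e' [[<- _] _ qr]]]|[[_ _ qe] er _]].
  + by apply: Or31; apply: (cl_arrow hT) T1 T2 pq.
  + by apply: Or32; exists p, c; split=> //; apply: le_trans pq qr.
  + apply: Or32; exists p, c; split=> //.
    exact: le_trans pq (le_trans qe er).
- move=> c i s h1 h2 n1 n2 sc; have [cr|ncr] := pselect (c <= r).
    exact: (collapse_low h1 cr (vone _ h1) cr).
  have [T1|[? [? []//]]] := collapse_high h1 ncr.
  case: h2 => [T2|[p [c' [es T2 pr]]]|[vs sr [e' T2 e'r]]].
  + by apply: Or31; apply: (cl_dum hT) T1 T2 _ _ _.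
  (* The bottom [Lo p c'], which is in [T], replaces [Hi p c'] in the rule, unless it is 0_c; but
     then c = p <= r. *)
  + have [[pc cc']|n] := pselect (p = c /\ c' = c).
      by rewrite -pc in ncr.
    apply: Or31; apply: (cl_dum hT) T1 T2 _ _ _ => //; last by rewrite es in sc.
    by move=> [? ?]; apply: n.
  + have [/= hc _ _] := vR _ h1; have [/= he _ _] := vT _ T2.
    have [ce|ec] := lev_total hc he; first by case: ncr; apply: le_trans ce e'r.
    apply: Or31; apply: (cl_dum hT) T1 T2 _ _ (ltW ec) => //.
    by move=> [E]; rewrite E ltxx in ec.
- move=> p q c h1 h2 pq qp; have [cr|ncr] := pselect (c <= r).
    exact: (collapse_low h1 cr (vone _ h1) cr).
  by apply: Or31; apply: (cl_incomp hT) (collapse_Lo h1 ncr) (collapse_Lo h2 ncr) pq qp.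
- move=> p c e h1 pc h2 ek.
  have [/= hc _ pc'] := vR _ h1.
  have kc : kap F p <= c by apply: kap_least.
  have [_ vk] := lev_valid (kap_lev F p).
  have [cr|ncr] := pselect (c <= r).
    exact: (collapse_low h1 cr vk (le_trans kc cr)).
  have T1 := collapse_Lo h1 ncr.
  case: h2 => [T2|[? [? []//]]|[_ er [e' T2 e'r]]].
    by apply: Or31; apply: (cl_low hT) T1 pc T2 ek.
  have [/= he' _ _] := vT _ T2.
  (* 0_e itself may be missing from [T], but 0_e' is there: either [kap F p] <= e' <= r, or the rule
     applies in [T] with e' for e. *)
  have [ke|ek'] := lev_total (kap_lev F p) he'.
    by apply: Or33; split=> //; [exact: le_trans ke e'r|exists e'].
  by apply: Or31; apply: (cl_low hT) T1 pc T2 ek'.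
- move=> p c q e h1 pc h2 ke ec qe qp.
  have [er|ner] := pselect (e <= r).
    exact: (collapse_low h2 er (vone _ h2) er).
  have ncr : ~ c <= r by move=> cr; apply: ner; apply: le_trans (ltW ec) cr.
  apply: Or31.
  by apply: (cl_cross hT) (collapse_Lo h1 ncr) pc (collapse_Lo h2 ner) _ _ _ _.
- move=> p c e i h1 pc h2 ke ec.
  have [er|ner] := pselect (e <= r).
    exact: (collapse_low h2 er (vone _ h2) er).
  have ncr : ~ c <= r by move=> cr; apply: ner; apply: le_trans (ltW ec) cr.
  have [T2|[? [? []//]]] := collapse_high h2 ner.
  by apply: Or31; apply: (cl_cross_dum hT) (collapse_Lo h1 ncr) pc T2 _ _.
Qed.

Lemma sub_collapse : T `<=` collapse r T.
Proof. by move=> s; apply: Or31. Qed.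

Lemma collapse_idem : collapse r (collapse r T) `<=` collapse r T.
Proof.
move=> s [//|[p [c [-> h pr]]]|[vs sr [e h er]]].
- have [cr|ncr] := pselect (c <= r).
    exact: (collapse_low (t := Hi p c) h cr (cl_valid collapse_closed h) cr).
  by apply: Or32; exists p, c; split=> //; apply: collapse_Lo.
- exact: (collapse_low h er vs sr).
Qed.

End Collapse.

Lemma collapse_mono r T U : T `<=` U -> collapse r T `<=` collapse r U.
Proof.
move=> TU s [/TU|[p [c [-> /TU h pr]]]|[vs sr [e /TU h er]]]; first exact: Or31.
- by apply: Or32; exists p, c.
- by apply: Or33; split=> //; exists e.
Qed.

Lemma collapse_le r q T : r <= q -> collapse r T `<=` collapse q T.
Proof.
move=> rq s [|[p [c [-> h pr]]]|[vs sr [e h er]]]; first exact: Or31.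
- by apply: Or32; exists p, c; split=> //; apply: le_trans rq.
- by apply: Or33; split; [|exact: le_trans rq|exists e => //; apply: le_trans rq].
Qed.

(** This makes the kernel of [collapse r] compatible with meets. On levels at most [r], the larger
    of the two witnesses 0_e, 0_f is in both sets by [cl_up]; elsewhere a top present in one set has
    its bottom there by [cl_hi]. *)
Lemma collapseI r T U : closed T -> closed U ->
  collapse r T `&` collapse r U `<=` collapse r (T `&` U).
Proof.
move=> hT hU s [h1 h2].
have act : lv s <= r -> collapse r (T `&` U) s.
  move=> sr.
  have [e Te er] := collapse_active hT h1 sr.
  have [f Uf fr] := collapse_active hU h2 sr.
  have [/= he _ _] := cl_valid hT Te.
  have [/= hf _ _] := cl_valid hU Uf.
  apply: Or33; split=> //; first exact: cl_valid (collapse_closed _ hT) _ h1.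
  have [ef|fe] := lev_total he hf.
    by exists f => //; split=> //; apply: (cl_up hT) Te _ _.
  by exists e => //; split=> //; apply: (cl_up hU) Uf _ (ltW fe).
have [/act//|ns] := pselect (lv s <= r).
have [Ts|[p [c [es Tp pr]]]] := collapse_high h1 ns.
- have [Us|[p [c [es Up pr]]]] := collapse_high h2 ns; first exact: Or31.
  apply: Or32; exists p, c; split=> //; split=> //; apply: (cl_hi hT).
  by rewrite -es.
- have [Us|[p' [c' [es' Up pr']]]] := collapse_high h2 ns.
  + apply: Or32; exists p, c; split=> //; split=> //; apply: (cl_hi hU).
    by rewrite -es.
  + move: es'; rewrite es => -[ep ec]; rewrite -ep -ec in Up.
    by apply: Or32; exists p, c.
Qed.

(** * Closures of finitary sets are finitary *)

Definition flip s := match s with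
  | Lo p c => Hi p c | Hi p c => Lo p c | Dum c i => Dum c i end.

(* The points satisfying the conclusion form a closed set: whenever a rule
   creates a new [Hi e e], its level [e] is already dominated through [K]. *)
Lemma finitary_cl J (X : set (pt P)) (K : set P) T : closed J ->
    (forall U, closed U -> T `<=` U -> J `<=` U) ->
    (forall s, X s -> X (flip s)) -> (forall s, X s -> K (lv s)) ->
    (forall s, X s -> K (kap F (col s))) ->
    (forall s, T s -> [\/ is_zero s, X s | exists M, [/\ K M, T (Hi M M) & lv s <= M]]) ->
    T `<=` J ->
  forall s, J s -> [\/ is_zero s, X s | exists M, [/\ K M, J (Hi M M) & lv s <= M]].
Proof.
move=> hJ least Xf XK Xk TX TJ s0 Js0.
pose B c := exists M, [/\ K M, J (Hi M M) & c <= M].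
pose V s := J s /\ [\/ is_zero s, X s | B (lv s)].
suff hV : closed V.
  suff /(_ s0 Js0)[] : J `<=` V by [].
  apply: least => // s Ts; split; first exact: TJ.
  have [?|?|[M [? ? ?]]] := TX s Ts; [exact: Or31|exact: Or32|apply: Or33].
  by exists M; split=> //; apply: TJ.
have VJ s : V s -> J s by case.
have vJ := cl_valid hJ.
have BW c e : B c -> e <= c -> B e.
  by move=> [M [? ? cM]] ec; exists M; split=> //; apply: le_trans cM.
have KB c : K c -> J (Hi c c) -> B c by move=> ? ?; exists c.
have Vone c : J (Hi c c) -> B c -> V (Hi c c) by move=> ? ?; split=> //; apply: Or33.
have VX s : V s -> ~ is_zero s -> X s \/ B (lv s).
  by move=> [_ [//|?|?]] _; [left|right].
have nzL p c : p <> c -> ~ is_zero (Lo p c) by move=> n [e [? ?]]; apply: n; congruence.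
have nzH p c : ~ is_zero (Hi p c) by case.
have nzD c i : ~ is_zero (Dum c i) by case.
split.
- by move=> s /VJ/vJ.
- by move=> s /VJ/(cl_lo hJ) h; split=> //; apply: Or31; exists (lv s).
- move=> e f /VJ h hf ef; split; first exact: (cl_up hJ) h hf ef.
  by apply: Or31; exists f.
- move=> c s Vc vs sc; have Jc := VJ _ Vc.
  split; first exact: (cl_one hJ) Jc vs sc.
  apply: Or33; apply: BW sc.
  by have [/XK/= h|//] := VX _ Vc (@nzH _ _); apply: KB.
- move=> p c Vc; split; first exact: (cl_hi hJ) (VJ _ Vc).
  by have [/Xf h|h] := VX _ Vc (@nzH _ _); [apply: Or32|apply: Or33].
- move=> p c q e V1 V2 pq; have J1 := VJ _ V1; have J2 := VJ _ V2.
  have J3 := cl_arrow hJ J1 J2 pq; split=> //.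
  have [epc|npc] := pselect (p = c); last first.
    by have [/Xf h|h] := VX _ V1 (nzL _ _ npc); [apply: Or32|apply: Or33].
  (* Here the arrow creates 1_c from 0_c and b_(q,e) with c <= q. Unless b_(q,e) is already
     dominated, 1_c lies below 1_e if q = e, is listed itself if c = q, and otherwise lies below
     1_(kap q), supplied by [cl_low]. *)
  apply: Or33; rewrite epc /= in J1 J3 pq *.
  have [hc _ _] := vJ _ J1; have [he _ qe] := vJ _ J2.
  have [X2|B2] := VX _ V2 (@nzH _ _); last by apply: BW B2 (le_trans pq qe).
  have [eqe|nqe] := pselect (q = e).
    rewrite eqe in X2 J2 pq; apply: BW pq.
    by apply: KB J2; apply: (XK _ X2).
  have JL := cl_hi hJ J2.
  have [kc|ck] := lev_total (kap_lev F q) hc.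
    have cq : c = q by apply/le_anti; rewrite pq (le_trans (kap_ge F q) kc).
    rewrite cq in J3 hc *; apply: KB => //.
    by rewrite -[X in K X](kap_id hc); apply: (Xk _ X2).
  have J4 := cl_low hJ JL nqe J1 ck.
  by apply: BW (ltW ck); apply: KB J4; apply: (Xk _ X2).
- move=> c i s V1 V2 n1 n2 sc.
  have J3 := cl_dum hJ (VJ _ V1) (VJ _ V2) n1 n2 sc; apply: Vone => //.
  by have [/XK/= h|//] := VX _ V1 (@nzD _ _); apply: KB.
- move=> p q c V1 V2 n1 n2.
  have J3 := cl_incomp hJ (VJ _ V1) (VJ _ V2) n1 n2; apply: Vone => //.
  have npc : p <> c by move=> pc; apply: n2; rewrite pc; have [] := vJ _ (VJ _ V2).
  by have [/XK/= h|//] := VX _ V1 (nzL _ _ npc); apply: KB.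
- move=> p c e V1 n V2 ek.
  have J3 := cl_low hJ (VJ _ V1) n (VJ _ V2) ek; apply: Vone => //.
  have [hc _ pc] := vJ _ (VJ _ V1).
  have [/Xk/= h|h] := VX _ V1 (nzL _ _ n); first exact: KB.
  by apply: BW h _; apply: kap_least.
- move=> p c q e V1 n V2 ke ec qe qp.
  have J3 := cl_cross hJ (VJ _ V1) n (VJ _ V2) ke ec qe qp; apply: Vone => //.
  by have [/XK/= h|//] := VX _ V2 (nzL _ _ qe); apply: KB.
- move=> p c e i V1 n V2 ke ec.
  have J3 := cl_cross_dum hJ (VJ _ V1) n (VJ _ V2) ke ec; apply: Vone => //.
  by have [/XK/= h|//] := VX _ V2 (@nzD _ _); apply: KB.
Qed.

Lemma finitary_closure T : T `<=` valid -> finitary T -> finitary (cl T).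
Proof.
move=> vT [X hX]; have hJ := cl_closed vT.
(* Flipping absorbs [cl_hi] and the arrows of proper intervals. [K] lists the levels at which a new
   top can arise: those of points of [Z] and, because of [cl_low], the values of [kap] at their
   colours. *)
pose Z := X ++ map flip X.
pose K := map lv Z ++ map (fun s => kap F (col s)) Z.
have flipK s : flip (flip s) = s by case: s.
exists (Z ++ map (fun M => Hi M M) K) => s Js.
have KZ u : u \in Z -> lv u \in K by move=> h; rewrite mem_cat map_f.
suff : [\/ is_zero s, s \in Z |
    exists M, [/\ M \in K, cl T (Hi M M) & lv s <= M]].
  case=> [?|sZ|[M [MK ? ?]]]; first exact: Or31.
    by apply: Or32; rewrite mem_cat sZ.
  apply: Or33; exists M; split=> //.
  by rewrite mem_cat; apply/orP; right; apply: map_f.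
apply: (@finitary_cl _ [set u | u \in Z] [set M | M \in K] T) => //=.
- by move=> V hV TV; apply: cl_sub.
- move=> u; rewrite mem_cat => /orP[h|/mapP[v h ->]].
    by rewrite mem_cat; apply/orP; right; apply: map_f.
  by rewrite flipK mem_cat h.
- by move=> u h; rewrite mem_cat; apply/orP; right; apply: (map_f (fun s => kap F (col s))).
- move=> u Tu; have [?|h|[M [h TM ?]]] := hX u Tu; [exact: Or31|apply: Or32|apply: Or33].
    by rewrite mem_cat h.
  by exists M; split=> //; apply: (KZ (Hi M M)); rewrite mem_cat h.
- exact: sub_cl.
Qed.

Lemma finitaryU T U : finitary T -> finitary U -> finitary (T `|` U).
Proof.
move=> [X hX] [Y hY]; exists (X ++ Y) => s [/hX|/hY] [?|h|[M [h TM ?]]].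
- exact: Or31.
- by apply: Or32; rewrite mem_cat h.
- by apply: Or33; exists M; split=> //; [rewrite mem_cat h|left].
- exact: Or31.
- by apply: Or32; rewrite mem_cat h orbT.
- by apply: Or33; exists M; split=> //; [rewrite mem_cat h orbT|right].
Qed.

Lemma finitary1 s : finitary [set s].
Proof. by exists [:: s] => t ->; apply: Or32; rewrite inE. Qed.

(** * Explicit closures of one or two points *)

Definition zeros c e : set (pt P) :=
  fun s => exists f, [/\ s = Lo f f, lev F f & c <= f \/ e <= f].

Definition lo_pair p c q e : set (pt P) :=
  fun s => [\/ s = Lo p c, s = Lo q e | zeros c e s].

(** The two configurations are the elementary moves of [cong_arrow]: one colour on two levels, or
    comparable colours on one level. [cl_incomp] is blocked by comparability, [cl_low] because no
    zero lies below the relevant [kap], and [cl_cross] because it requires both different colours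
    and different levels. *)
Lemma lo_pair_closed p c q e : valid (Lo p c) -> valid (Lo q e) ->
  p = q \/ p <= q /\ c = e -> closed (lo_pair p c q e).
Proof.
move=> v1 v2 pq; have [/= hc p0 pc] := v1; have [/= he q0 qe] := v2.
have Lv s : lo_pair p c q e s -> valid s.
  by case=> [->|->|[f [-> hf _]]] //; have [] := lev_valid hf.
have LL s : lo_pair p c q e s -> exists a b, s = Lo a b.
  by case=> [->|->|[f [-> _ _]]]; [exists p, c|exists q, e|exists f, f].
have LH a b : ~ lo_pair p c q e (Hi a b) by move=> /LL[? []].
have LD a b : ~ lo_pair p c q e (Dum a b) by move=> /LL[? []].
have Llv s : lo_pair p c q e s -> lev F (lv s) /\ (c <= lv s \/ e <= lv s).
  by case=> [->|->|[f [-> hf h]]] //=; split=> //; [left|right].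
split=> //.
- by move=> s /Llv[h1 h2]; apply: Or33; exists (lv s).
- move=> a f /Llv[/= ha h] hf af; apply: Or33; exists f; split=> //.
  by case: h => h; [left|right]; apply: le_trans af.
- by move=> a s /LH.
- by move=> ? ? /LH.
- by move=> ? ? ? ? _ /LH.
- by move=> ? ? ? /LD.
- move=> a b g h1 h2 ab ba.
  have [/= _ _ ag] := Lv _ h1; have [/= _ _ bg] := Lv _ h2.
  case: h1 => [[ea eg]|[ea eg]|[f [[ea eg] _ _]]]; last by case: ba; rewrite ea -eg.
    case: h2 => [[eb _]|[eb eg']|[f [[eb eg'] _ _]]]; last by case: ab; rewrite eb -eg'.
      by case: ab; rewrite ea eb.
    by case: ab; rewrite ea eb; case: pq => [->|[]].
  case: h2 => [[eb _]|[eb eg']|[f [[eb eg'] _ _]]]; last by case: ab; rewrite eb -eg'.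
    by case: ba; rewrite ea eb; case: pq => [->|[]].
  by case: ab; rewrite ea eb.
- move=> a g f h1 ag /Llv[/= _ h2] fk; exfalso.
  have lt1 : f < kap F a -> kap F a <= c -> kap F a <= e -> False.
    move=> l h3 h4; case: h2 => h.
      by have := lt_le_trans l (le_trans h3 h); rewrite ltxx.
    by have := lt_le_trans l (le_trans h4 h); rewrite ltxx.
  apply: lt1 => //.
  + case: h1 => [[-> _]|[-> _]|[b [[ea eg] _ _]]]; [| |by case: ag; rewrite ea eg].
      exact: kap_least.
    by case: pq => [<-|[_ ->]]; apply: kap_least.
  + case: h1 => [[-> _]|[-> _]|[b [[ea eg] _ _]]]; [| |by case: ag; rewrite ea eg].
      by case: pq => [->|[_ <-]]; apply: kap_least.
    exact: kap_least.
- move=> a g b f h1 ag h2 _ fg bf ba; exfalso.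
  have [[eb ef]|[eb ef]|[x [[eb ef] _ _]]] := h2; last by case: bf; rewrite eb ef.
    case: h1 => [[ea eg]|[ea eg]|[x [[ea eg] _ _]]]; last by case: ag; rewrite ea eg.
      by case: ba; rewrite ea eb.
    case: pq => [E|[_ E]]; first by case: ba; rewrite ea eb.
    by rewrite ef eg E ltxx in fg.
  case: h1 => [[ea eg]|[ea eg]|[x [[ea eg] _ _]]]; last by case: ag; rewrite ea eg.
    case: pq => [E|[_ E]]; first by case: ba; rewrite ea eb.
    by rewrite ef eg E ltxx in fg.
  by case: ba; rewrite ea eb.
- by move=> ? ? ? ? _ _ /LD.
Qed.

Lemma cl_Lo p c : valid (Lo p c) ->
  forall s, cl [set Lo p c] s -> s = Lo p c \/ zeros c c s.
Proof.
move=> v s; suff : cl [set Lo p c] `<=` lo_pair p c p c.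
  by move=> h /h[->|->|]; [left|left|right].
by apply: cl_sub; [apply: lo_pair_closed => //; left|move=> _ ->; apply: Or31].
Qed.

Lemma cl_Dum c i : valid (Dum c i) ->
  forall s, cl [set Dum c i] s -> s = Dum c i \/ zeros c c s.
Proof.
move=> v; have [/= hc _ _] := v.
pose T s := s = Dum c i \/ zeros c c s.
suff hT : closed T by move=> s /(_ T); apply; split=> // _ ->; left.
have Tlv s : T s -> lev F (lv s) /\ c <= lv s.
  by case=> [->|[f [-> hf [h|h]]]] //=.
have TH a b : ~ T (Hi a b) by case=> // -[? []].
have TL a b : T (Lo a b) -> a = b by case=> // -[? [[-> ->]]].
split=> //.
- by move=> s [->|[f [-> hf _]]] //; have [] := lev_valid hf.
- by move=> s /Tlv[h1 h2]; right; exists (lv s); split=> //; left.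
- move=> e f /Tlv[/= _ h] hf ef; right; exists f; split=> //; left.
  exact: le_trans ef.
- by move=> ? ? /TH.
- by move=> ? ? /TH.
- by move=> ? ? ? ? _ /TH.
- move=> e j s [[-> ->]|[? []//]] [//|[f [-> hf h]]] _ n /= fc.
  by case: n; have -> : f = c by apply/le_anti; rewrite fc; case: h.
- by move=> p q e /TL-> /TL->; rewrite lexx.
- by move=> p e f /TL.
- by move=> p e q f /TL.
- by move=> p e f j /TL.
Qed.

(** Together with the zeros forced by any point of level [c], this shows that the ends of a proper
    interval differ in the single point [Hi p c]. *)
Lemma cl_Hi p c : valid (Hi p c) -> p <> c ->
  forall s, cl [set Hi p c] s -> [\/ s = Hi p c, s = Lo p c | zeros c c s].
Proof.
move=> v pc; have [/= hc p0 pc'] := v.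
pose T s := [\/ s = Hi p c, s = Lo p c | zeros c c s].
suff hT : closed T by move=> s /(_ T); apply; split=> // _ ->; apply: Or31.
have Tlv s : T s -> lev F (lv s) /\ c <= lv s.
  by case=> [->|->|[f [-> hf [h|h]]]] //=.
have TH a b : T (Hi a b) -> a = p /\ b = c by case=> [[-> ->]|//|[? []]].
have TD a b : ~ T (Dum a b) by case=> // -[? []].
have TL a b : T (Lo a b) -> a = b \/ a = p /\ b = c.
  by case=> // [[-> ->]|[? [[-> ->]]]]; [right|left].
split=> //.
- by move=> s [->|->|[f [-> hf _]]] //; have [] := lev_valid hf.
- by move=> s /Tlv[h1 h2]; apply: Or33; exists (lv s); split=> //; left.
- move=> e f /Tlv[/= _ h] hf ef; apply: Or33; exists f; split=> //; left.
  exact: le_trans ef.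
- by move=> a s /TH[-> /pc].
- by move=> a b /TH[-> ->]; apply: Or32.
- move=> a b q e h1 /TH[-> _] ap.
  have [/= _ bc] := Tlv _ h1; have [ab|[-> ->]] := TL _ _ h1; last exact: Or31.
  case: pc; apply/le_anti; rewrite pc' /=.
  by apply: le_trans bc _; rewrite -ab.
- by move=> ? ? ? /TD.
- move=> a b e h1 h2 ab ba.
  have [/= _ ce] := Tlv _ h1.
  have [ea|[ea ee]] := TL _ _ h1; have [eb|[eb ee']] := TL _ _ h2.
  + by case: ab; rewrite ea eb.
  + by case: ba; rewrite ea eb ee'.
  + by case: ab; rewrite ea eb ee.
  + by case: ab; rewrite ea eb.
- move=> a b e h1 ab /Tlv[/= _ ce] ek; exfalso.
  have [//|[ea _]] := TL _ _ h1.
  have : e < e.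
    by apply: lt_le_trans ek _; apply: le_trans ce; rewrite ea; apply: kap_least.
  by rewrite ltxx.
- move=> a b q e h1 ab h2 _ eb qe qa; exfalso.
  have [//|[ea _]] := TL _ _ h1; have [//|[eq _]] := TL _ _ h2.
  by apply: qa; rewrite ea eq.
- by move=> ? ? ? ? _ _ /TD.
Qed.

(** * The lattice of nonempty finitary closed sets *)

Definition member T := [/\ closed T, T !=set0 & finitary T].

Definition carrier := {T : set (pt P) | member T}.

HB.instance Definition _ := gen_eqMixin carrier.
HB.instance Definition _ := gen_choiceMixin carrier.

Implicit Types x y z w : carrier.

Lemma carrier_eq x y : sval x = sval y -> x = y.
Proof. by case: x y => [T hT] [U hU] /= E; apply: eq_exist. Qed.

Definition carrier_le x y := `[< sval x `<=` sval y >].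

Lemma carrier_le_refl : reflexive carrier_le.
Proof. by move=> x; apply/asboolP. Qed.

Lemma carrier_le_anti : antisymmetric carrier_le.
Proof.
move=> x y /andP[/asboolP xy /asboolP yx].
by apply: carrier_eq; apply/seteqP.
Qed.

Lemma carrier_le_trans : transitive carrier_le.
Proof.
by move=> y x z /asboolP xy /asboolP yz; apply/asboolP; apply: subset_trans yz.
Qed.

HB.instance Definition _ := Order.Le_isPOrder.Build (Order.Disp tt tt) carrier
  carrier_le_refl carrier_le_anti carrier_le_trans.

(** The larger of two zeros lies in both sets, so meets stay nonempty. The empty set has to stay
    out: [collapse r] fixes it, so identifying it with another set would give a congruence of no
    colour. *)
Lemma memberI T U : member T -> member U -> member (T `&` U).
Proof.
move=> [hT [s Ts] fT] [hU [t Ut] fU]; split; [exact: closedI| |exact: finitaryI].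
have Ts' := cl_lo hT Ts; have Ut' := cl_lo hU Ut.
have [hs _ _] := cl_valid hT Ts; have [ht _ _] := cl_valid hU Ut.
have [st|ts] := lev_total hs ht.
- by exists (Lo (lv t) (lv t)); split=> //; apply: (cl_up hT) Ts' ht st.
- by exists (Lo (lv s) (lv s)); split=> //; apply: (cl_up hU) Ut' hs (ltW ts).
Qed.

Lemma memberU T U : member T -> member U -> member (cl (T `|` U)).
Proof.
move=> [hT [s Ts] fT] [hU _ fU].
have v : T `|` U `<=` valid by move=> t [/(cl_valid hT)|/(cl_valid hU)].
split; first exact: cl_closed.
- by exists s; apply: sub_cl; left.
- by apply: finitary_closure v _; apply: finitaryU.
Qed.

Definition carrier_meet x y : carrier := exist _ _ (memberI (svalP x) (svalP y)).
Definition carrier_join x y : carrier := exist _ _ (memberU (svalP x) (svalP y)).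

Lemma carrier_meetP x y z :
  (x <= carrier_meet y z)%O = (x <= y)%O && (x <= z)%O.
Proof.
apply/asboolP/andP => [h|[/asboolP h1 /asboolP h2]].
  by split; apply/asboolP => s /h[].
by move=> s xs; split; [apply: h1|apply: h2].
Qed.

Lemma carrier_joinP x y z :
  (carrier_join x y <= z)%O = (x <= z)%O && (y <= z)%O.
Proof.
apply/asboolP/andP => [h|[/asboolP h1 /asboolP h2]].
  by split; apply/asboolP => s xs; apply: h; apply: sub_cl; [left|right].
by apply: cl_sub; [case: (svalP z)|move=> s [/h1|/h2]].
Qed.

HB.instance Definition _ := Order.POrder_MeetJoin_isLattice.Build
  (Order.Disp tt tt) carrier carrier_meetP carrier_joinP.

Lemma carrier_closed x : closed (sval x).
Proof. by case: (svalP x). Qed.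

Lemma carrier_leP x y : reflect (sval x `<=` sval y) (x <= y)%O.
Proof. exact: asboolP. Qed.

Lemma sval_meet x y : sval (x `&` y)%O = sval x `&` sval y.
Proof. by []. Qed.

Lemma sval_joinl x y : sval x `<=` sval (x `|` y)%O.
Proof. by apply/carrier_leP; rewrite leUl. Qed.

Lemma sval_joinr x y : sval y `<=` sval (x `|` y)%O.
Proof. by apply/carrier_leP; rewrite leUr. Qed.

Lemma member_gen s : valid s -> member (cl [set s]).
Proof.
move=> v; have v' : [set s] `<=` valid by move=> _ ->.
split; first exact: cl_closed.
- by exists s; apply: sub_cl.
- by apply: finitary_closure v' _; apply: finitary1.
Qed.

Definition gen s (v : valid s) : carrier := exist _ _ (member_gen v).

Lemma gen_self s (v : valid s) : sval (gen v) s.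
Proof. exact: sub_cl. Qed.

Lemma gen_le s (v : valid s) x : sval x s -> (gen v <= x)%O.
Proof.
move=> xs; apply/carrier_leP; apply: cl_sub (carrier_closed x) _.
by move=> _ ->.
Qed.

(* [valid] only sees [col] and [lv], so that one proof serves for both ends of
   an interval (and, when [p = c], for the points [Dum c i]). *)
Definition lo p c (v : valid (Lo p c)) : carrier := @gen (Lo p c) v.
Definition hi p c (v : valid (Lo p c)) : carrier := @gen (Hi p c) v.

Lemma lo_le_hi p c (v : valid (Lo p c)) : (lo v <= hi v)%O.
Proof. by apply: gen_le; apply: (cl_hi (carrier_closed _)); apply: gen_self. Qed.

Lemma zeros_sub x s c : sval x s -> lv s = c -> zeros c c `<=` sval x.
Proof.
move=> xs sc t [f [-> hf h]]; have cf : c <= f by case: h.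
apply: (cl_up (carrier_closed x)) hf cf.
by rewrite -sc; apply: cl_lo (carrier_closed x) _ xs.
Qed.

(** * Consequences of collapsing one pair *)

Section Congruence.
Variable th : set (carrier * carrier).
Hypothesis hth : is_congruence th.

(* Meets and joins with two of the three points [Dum c i] not involved in [s]. *)
Lemma cong_isolated c (v : valid (Lo c c)) x s :
  th (lo v, x) -> sval x s -> s <> Lo c c -> lv s <= c -> th (lo v, hi v).
Proof.
move=> h xs ns sc.
pose z i : carrier := @gen (Dum c i) v.
have lo_z i : (lo v <= z i)%O.
  by apply: gen_le; apply: (cl_lo (carrier_closed _) (gen_self _)).
have zI i j : i <> j -> (z i `&` z j)%O = lo v.
  move=> ij; apply/le_anti; rewrite lexI !lo_z !andbT.
  apply/carrier_leP => t [/(cl_Dum v) h1 /(cl_Dum v) h2].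
  suff : zeros c c t by apply: zeros_sub; first exact: gen_self.
  by case: h1 h2 => [-> [[]|]|].
have step i j : s <> Dum c i -> i <> j -> th (lo v, z j).
  move=> si ij; have := cong_meetl (z j) hth (cong_joinl (z i) hth h).
  rewrite (join_idPl (lo_z i)) (zI _ _ (nesym ij)).
  rewrite (meet_idPl _) //; apply: gen_le.
  apply: (cl_one (carrier_closed _)) (v : valid (Dum c j)) (lexx _).
  apply: (cl_dum (carrier_closed _)) (sval_joinl (gen_self _)) (sval_joinr xs) _ _ _ => //.
have zall j : th (lo v, z j).
  have [i [si ij]] : exists i, s <> Dum c i /\ i <> j.
    have [[i es]|n] := pselect (exists i, s = Dum c i); last first.
      by case: j => [b|]; [exists None|exists (Some true)]; split=> // e; apply: n; eexists; exact: e.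
    rewrite es; case: i j {es} => [[]|] [[]|];
      try (by exists None; split); try (by exists (Some true); split);
      by exists (Some false); split.
  exact: step si ij.
have := cong_join hth (zall None) (zall (Some true)); rewrite joinxx => h2.
apply: (cong_between hth) h2; first exact: lo_le_hi.
apply: gen_le; apply: (cl_dum (carrier_closed _)) (sval_joinl (gen_self _))
  (sval_joinr (gen_self _)) _ _ _ => //=.
Qed.

(** If [p <> c], meeting with [hi v] turns the pair into the ends of the interval. If [p = c], some
    atom [Dum c i] is missing from [x], since two of them yield 1_c; meeting with it leaves 0_c
    against that atom, and [cong_isolated] applies. *)
Lemma cong_interval x y p c (v : valid (Lo p c)) :
  th (x, y) -> sval x (Lo p c) -> sval y (Hi p c) -> ~ sval x (Hi p c) ->
  th (lo v, hi v).
Proof.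
move=> h xl yh nxh.
have [epc|npc] := pselect (p = c); last first.
  have := cong_meetl (hi v) hth h; rewrite (meet_idPl (gen_le _ yh)).
  suff -> : (hi v `&` x)%O = lo v by [].
  apply/le_anti; rewrite lexI lo_le_hi gen_le // !andbT.
  apply/carrier_leP => s [/(cl_Hi v npc)[->|->|zs]] xs //; first exact: gen_self.
  by apply: zeros_sub zs; first exact: gen_self.
move: v xl yh nxh; rewrite epc => v xl yh nxh.
have [i ni] : exists i, ~ sval x (Dum c i).
  apply: contrapT => n; apply: nxh.
  have a i : sval x (Dum c i) by apply: contrapT => ni; apply: n; exists i.
  exact: (cl_dum (carrier_closed _)) (a None) (a (Some true)) _ _ _.
have yd : sval y (Dum c i).
  by apply: (cl_one (carrier_closed _)) yh (v : valid (Dum c i)) (lexx _).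
have := cong_meetl (@gen (Dum c i) v) hth h; rewrite (meet_idPl (gen_le _ yd)).
suff -> : (@gen (Dum c i) v `&` x)%O = lo v.
  by move=> h'; apply: cong_isolated h' (gen_self _) _ _.
apply/le_anti; rewrite lexI !gen_le //= ?andbT; last first.
  exact: (cl_lo (carrier_closed _) (gen_self _)).
apply/carrier_leP => s [/(cl_Dum v) [->|zs]] xs //.
by apply: zeros_sub zs; first exact: gen_self.
Qed.

(** Joining with the lower end of the target makes [cl_arrow] add its top, which [lo_pair_closed]
    shows was absent before. The general case takes two such moves through the higher of the two
    levels. *)
Lemma cong_arrow q e p c (v : valid (Lo q e)) (w : valid (Lo p c)) :
  p <= q -> th (lo v, hi v) -> th (lo w, hi w).
Proof.
have step q' e' p' c' (v' : valid (Lo q' e')) (w' : valid (Lo p' c')) :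
    p' = q' \/ p' <= q' /\ c' = e' -> th (lo v', hi v') -> th (lo w', hi w').
  move=> pq /(cong_joinl (lo w') hth) h.
  have pq' : p' <= q' by case: pq => [->|[]].
  apply: cong_interval h _ _ _.
  - by apply: sval_joinl; apply: gen_self.
  - apply: (cl_arrow (carrier_closed _)) pq'.
      by apply: sval_joinl; apply: gen_self.
    by apply: sval_joinr; apply: gen_self.
  - have hE := lo_pair_closed w' v' pq.
    have : sval (lo w' `|` lo v')%O `<=` lo_pair p' c' q' e'.
      apply: cl_sub => // s [] /cl_sub; apply=> //.
        by move=> _ ->; apply: Or31.
      by move=> _ ->; apply: Or32.
    by move=> sub /sub [|| [? []]].
move=> pq; have [/= hc p0 pc] := w; have [/= he q0 qe] := v.
have [ce|/ltW ec] := lev_total hc he.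
- have u : valid (Lo p e) by split=> //=; apply: le_trans pc ce.
  move=> /(step _ _ _ _ v u (or_intror (conj pq erefl))).
  by apply: step; left.
- have u : valid (Lo q c) by split=> //=; apply: le_trans qe ec.
  move=> /(step _ _ _ _ v u (or_introl erefl)).
  by apply: step; right.
Qed.

End Congruence.

(** * The congruences induced by [collapse] *)

Definition collapse_cong r : set (carrier * carrier) :=
  fun xy => collapse r (sval xy.1) = collapse r (sval xy.2).

Lemma collapse_join_sub r x y z : collapse r (sval x) = collapse r (sval y) ->
  collapse r (sval (x `|` z)%O) `<=` collapse r (sval (y `|` z)%O).
Proof.
move=> E; apply: subset_trans (@collapse_idem r _ (carrier_closed _)).
apply: collapse_mono; apply: cl_sub; first exact: collapse_closed (carrier_closed _).
move=> s [xs|zs]; last by apply: sub_collapse; apply: sval_joinr.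
have /(collapse_mono (sval_joinl (y := z))) // : collapse r (sval y) s.
by rewrite -E; apply: sub_collapse.
Qed.

Lemma collapse_meet r x y :
  collapse r (sval (x `&` y)%O) = collapse r (sval x) `&` collapse r (sval y).
Proof.
apply/seteqP; split; last exact: collapseI (carrier_closed _) (carrier_closed _).
by move=> s h; split; apply: collapse_mono h => t [].
Qed.

Lemma collapse_congP r : is_congruence (collapse_cong r).
Proof.
split.
- by [].
- by move=> x y h; apply: esym h.
- by move=> x y z h1 h2; apply: etrans h1 h2.
- move=> x x' y y'; rewrite /collapse_cong [in X in X -> _]/= => xx'.
  rewrite [in X in X -> _]/= => yy'.
  by apply: etrans (collapse_meet _ _ _) _; rewrite xx' yy' -collapse_meet.
- move=> x x' y y'; rewrite /collapse_cong [in X in X -> _]/= => xx'.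
  rewrite [in X in X -> _]/= => yy'.
  apply: (@etrans _ _ (collapse r (sval (x' `|` y)%O))).
    by apply/seteqP; split; apply: collapse_join_sub.
  have -> : (x' `|` y)%O = (y `|` x')%O by exact: joinC.
  rewrite [X in _ = collapse r (sval X)](_ : _ = (y' `|` x')%O); last exact: joinC.
  by apply/seteqP; split; apply: collapse_join_sub.
Qed.

Lemma collapse_cong_interval r p c (v : valid (Lo p c)) :
  collapse_cong r (lo v, hi v) <-> p <= r.
Proof.
change (collapse r (sval (lo v)) = collapse r (sval (hi v)) <-> p <= r); split.
  move=> E; have : collapse r (sval (lo v)) (Hi p c).
    by rewrite E; apply: sub_collapse; apply: gen_self.
  case=> [/(cl_Lo v)[//|[? []//]]|[? [? [[<- _] _]]]//|[_ cr _]].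
  by have [_ _ /= pc] := v; apply: le_trans cr.
move=> pr; apply/seteqP; split.
  by apply: collapse_mono; apply/carrier_leP; apply: lo_le_hi.
apply: subset_trans (@collapse_idem r _ (carrier_closed _)).
apply: collapse_mono; apply: cl_sub; first exact: collapse_closed (carrier_closed _).
by move=> _ ->; apply: Or32; exists p, c; split=> //; apply: gen_self.
Qed.

(** [cong_arrow] gives the inclusion; conversely [collapse_cong q] contains the interval of colour
    [q] but none of a colour not below [q]. *)
Lemma con_interval_le p c q e (v : valid (Lo p c)) (w : valid (Lo q e)) :
  con (lo v) (hi v) `<=` con (lo w) (hi w) <-> p <= q.
Proof.
split=> [sub|pq].
  apply/(collapse_cong_interval _ v).
  have : con (lo w) (hi w) `<=` collapse_cong q.
    apply: con_least; first exact: collapse_congP.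
    by apply/collapse_cong_interval.
  by apply; apply: sub; apply: con_collapses.
apply: con_least; first exact: con_congruence.
apply: (cong_arrow (con_congruence _ _) (v := w)) pq _.
exact: con_collapses.
Qed.

(** * Classification of principal congruences *)

Definition split_interval T p c := T (Lo p c) /\ ~ T (Hi p c).

(** For incomparable colours with e <= c, one of [cl_incomp] (c = e), [cl_low] (e < kap p) and
    [cl_cross] (kap p <= e < c) puts into [T] a 1 whose level is high enough to fill one of the
    intervals. *)
Lemma split_interval_total T p c q e : closed T ->
  split_interval T p c -> split_interval T q e -> p <= q \/ q <= p.
Proof.
move=> hT.
wlog ec : p c q e / e <= c.
  move=> W h1 h2; have [/= he _ _] := cl_valid hT h2.1.
  have [/= hc _ _] := cl_valid hT h1.1.
  have [/W|/ltW /W] := lev_total he hc; first exact.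
  by move=> /(_ _ _ h2 h1) []; [right|left].
move=> [pl ph] [ql qh].
have vp := cl_valid hT pl; have vq := cl_valid hT ql.
have [/= hc p0 pc] := vp; have [/= he q0 qe] := vq.
apply: contrapT => n.
have [pq qp] : ~ p <= q /\ ~ q <= p by split=> h; apply: n; [left|right].
have npc : p <> c by move=> E; apply: qp; rewrite E; apply: le_trans ec.
have [Ec|nec] := pselect (c = e).
  rewrite -Ec in ql.
  by apply: ph; apply: (cl_one hT (s := Hi p c)) (cl_incomp hT pl ql pq qp) vp (lexx _).
have ec' : e < c by rewrite lt_neqAle ec andbT; apply/eqP => E; apply: nec.
have [ke|ek] := lev_total (kap_lev F p) he; last first.
  have K := cl_low hT pl npc (cl_lo hT ql) ek.
  by apply: qh; apply: (cl_one hT (s := Hi q e)) K vq (ltW ek).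
have nqe : q <> e by move=> E; apply: pq; rewrite E; apply: le_trans (kap_ge F p) ke.
apply: qh; apply: (cl_one hT (s := Hi q e)) (cl_cross hT pl npc ql ke ec' nqe _) vq (lexx _).
by move=> E; apply: qp; rewrite E.
Qed.

Lemma separating_interval (th : set (carrier * carrier)) x y s :
  is_congruence th -> th (x, y) -> (x <= y)%O -> sval y s -> ~ sval x s ->
  exists p c (v : valid (Lo p c)),
    [/\ split_interval (sval x) p c, th (lo v, hi v) & collapse p (sval x) s].
Proof.
move=> hth h /carrier_leP xy ys nxs.
have hx := carrier_closed x; have hy := carrier_closed y.
have vs := cl_valid hy ys; have [hl _ _] := vs.
have [v1 _] := lev_valid hl.
have [[p [c [es xp]]]|nhi] :=
    pselect (exists p c, s = Hi p c /\ sval x (Lo p c)).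
  have v := cl_valid hx xp; rewrite es in ys nxs *.
  exists p, c, v; split=> //.
  - exact: (cong_interval hth) h xp ys nxs.
  - by apply: Or32; exists p, c.
(* If 0_(lv s) is not in [x], let 0_m be the least zero of [x]. Then lv s < m, and meeting with
   0_(lv s) identifies it with 0_m inside [0_m, 1_m], so colour [m] is collapsed. *)
have [xl|nxl] := pselect (sval x (Lo (lv s) (lv s))); last first.
  have [t xt] : sval x !=set0 by case: (svalP x).
  have [m xm mmin] : exists2 m, sval x (Lo m m) &
      forall e, sval x (Lo e e) -> m <= e.
    apply: (@lev_min _ _ F [set e | sval x (Lo e e)]).
      by move=> e /(cl_valid hx)[].
    by exists (lv t); apply: (cl_lo hx).
  have vm := cl_valid hx xm; have [/= hm _ _] := vm.
  have [ml|lm] := lev_total hm hl.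
    by case: nxl; apply: (cl_up hx) xm hl ml.
  exists m, m, vm; split.
  - by split=> // xo; apply: nxs; apply: (cl_one hx) xo vs (ltW lm).
  - have := cong_meetl (lo v1) hth h.
    have -> : (lo v1 `&` y)%O = lo v1.
      by apply/meet_idPl; apply: gen_le; apply: (cl_lo hy).
    have -> : (lo v1 `&` x)%O = lo vm.
      apply/le_anti; rewrite lexI (gen_le _ xm) andbT gen_le ?andbT.
        apply/carrier_leP => t' [/(cl_Lo v1) h1 xt'].
        have [f E] : exists f, t' = Lo f f.
          by case: h1 => [->|[f [-> _ _]]]; [exists (lv s)|exists f].
        rewrite E in xt' *; have [hf _ _] := cl_valid hx xt'.
        by apply: (cl_up (carrier_closed _)) (gen_self _) hf (mmin _ xt').
      exact: (cl_up (carrier_closed _)) (gen_self _) hm (ltW lm).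
    move=> h'; apply: (cong_isolated hth) h' (gen_self _) _ (ltW lm).
    by move=> [E]; rewrite E ltxx in lm.
  - by apply: Or33; split=> //; [exact: ltW|exists m].
exists (lv s), (lv s), v1; split.
- by split=> // xo; apply: nxs; apply: (cl_one hx) xo vs (lexx _).
(* The point [t] generates only zeros besides itself, so its meet with [x] is exactly 0_(lv s). It
   is [s], or the bottom [Lo p c] when [s] is [Hi p c]. *)
- have [t [yt nxt tl nt ht]] : exists t, [/\ sval y t, ~ sval x t, lv t = lv s,
      t <> Lo (lv s) (lv s) &
      valid t /\ forall u, cl [set t] u -> u = t \/ zeros (lv s) (lv s) u].
    case: s => [p c|p c|c i] /= in ys nxs vs hl v1 nhi xl *.
    + exists (Lo p c); split=> //; first by move=> E; rewrite E in nxs.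
      by split=> //; apply: cl_Lo.
    + have nxp : ~ sval x (Lo p c) by move=> E; apply: nhi; exists p, c.
      exists (Lo p c); split=> //; first exact: (cl_hi hy).
        by move=> E; rewrite E in nxp.
      by split; [|apply: cl_Lo].
    + by exists (Dum c i); split=> //; split=> //; apply: cl_Dum.
  case: ht => vt ht.
  have := cong_meetl (gen vt) hth h; rewrite (meet_idPl (gen_le vt yt)).
  have -> : (gen vt `&` x)%O = lo v1.
    apply/le_anti; rewrite lexI (gen_le _ xl) andbT gen_le ?andbT; last first.
      by rewrite -tl; apply: (cl_lo (carrier_closed _)); apply: gen_self.
    apply/carrier_leP => u [/ht [->|zu]] xu //.
    by apply: zeros_sub zu; first exact: gen_self.
  move=> h'; apply: (cong_isolated hth) h' (gen_self _) nt _.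
  by rewrite tl.
- by apply: Or33; split=> //; exists (lv s).
Qed.

(** Each added point is reached by joining [x] with the top of an interval whose bottom is in [x]
    and whose colour is at most [p]; [cong_arrow] collapses that interval. *)
Lemma collapse_con p c (v : valid (Lo p c)) x s : collapse p (sval x) s ->
  exists2 z, con (lo v) (hi v) (x, z) & (x <= z)%O /\ sval z s.
Proof.
have hth := con_congruence (lo v) (hi v).
have hlh := @con_collapses _ _ (lo v) (hi v).
have hx := carrier_closed x.
case=> [xs|[q [e [-> xq qp]]]|[vs sp [e xe ep]]].
- by exists x => //; apply: (cong_refl hth).
- have w := cl_valid hx xq.
  have := cong_joinl x hth (cong_arrow hth w qp hlh).
  rewrite (join_idPl (gen_le _ xq)) => h.
  by exists (x `|` hi w)%O => //; split; [exact: leUl|apply: sval_joinr; apply: gen_self].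
- have [hs _ _] := vs; have [/= he _ _] := cl_valid hx xe.
  have [m [xm mp sm]] : exists m, [/\ sval x (Lo m m), m <= p & lv s <= m].
    have [es|se] := lev_total he hs.
      by exists (lv s); split=> //; apply: (cl_up hx) xe hs es.
    by exists e; split=> //; apply: ltW.
  have w := cl_valid hx xm.
  have := cong_joinl x hth (cong_arrow hth w mp hlh).
  rewrite (join_idPl (gen_le _ xm)) => h.
  exists (x `|` hi w)%O => //; split; first exact: leUl.
  apply: sval_joinr.
  exact: (cl_one (carrier_closed _)) (gen_self _) vs sm.
Qed.

(** The generators are the least 0_m of [y] and the points of [y] in its finitary list: [cl_up]
    recovers the other zeros, and [cl_one] the points below a listed top. *)
Lemma finite_generation y : exists X : seq (pt P),
  (forall s, s \in X -> sval y s) /\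
  forall U, closed U -> (forall s, s \in X -> U s) -> sval y `<=` U.
Proof.
have hy := carrier_closed y.
have [[t yt] [X hX]] : sval y !=set0 /\ finitary (sval y) by case: (svalP y).
have [m ym mmin] : exists2 m, sval y (Lo m m) &
    forall e, sval y (Lo e e) -> m <= e.
  apply: (@lev_min _ _ F [set e | sval y (Lo e e)]).
    by move=> e /(cl_valid hy)[].
  by exists (lv t); apply: (cl_lo hy).
exists (Lo m m :: [seq s <- X | `[< sval y s >]]); split.
  by move=> s; rewrite inE mem_filter => /orP[/eqP->//|/andP[/asboolP]].
move=> U hU sub s ys.
have Um : U (Lo m m) by apply: sub; rewrite inE eqxx.
have XU u : u \in X -> sval y u -> U u.
  move=> uX yu; apply: sub; rewrite inE mem_filter uX andbT; apply/orP; right.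
  exact/asboolP.
have [[f E]|sX|[M [MX yM sM]]] := hX s ys.
- rewrite E in ys *; have [hf _ _] := cl_valid hy ys.
  exact: (cl_up hU) Um hf (mmin _ ys).
- exact: XU.
- by apply: (cl_one hU) (XU _ MX yM) (cl_valid hy ys) sM.
Qed.

Lemma con_of_collapse p c (v : valid (Lo p c)) x y :
  (x <= y)%O -> sval y `<=` collapse p (sval x) -> con (lo v) (hi v) (x, y).
Proof.
move=> xy sub; have hth := con_congruence (lo v) (hi v).
have key (X : seq (pt P)) : {subset X <= [pred s | `[< sval y s >]]} ->
    exists2 z, con (lo v) (hi v) (x, z) &
      [/\ (x <= z)%O, (z <= y)%O & forall s, s \in X -> sval z s].
  elim: X => [|s X IH] hX; first by exists x; [exact: (cong_refl hth)|split].
  have [|z hz [xz zy zX]] := IH; first by move=> t tX; apply: hX; rewrite inE tX orbT.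
  have ys : sval y s by apply/asboolP; apply: (hX s); rewrite inE eqxx.
  have [w hw [xw ws]] := collapse_con v (sub _ ys).
  (* Cutting by [y] keeps the element below [y], so that once it contains all generators it equals
     [y]. *)
  exists (y `&` (z `|` w))%O.
    have := cong_join hth hz hw; rewrite joinxx.
    by apply: (cong_between hth); [rewrite lexI xy lexU2 // xz|exact: leIr].
  split; [by rewrite lexI xy lexU2 // xz|exact: leIl|].
  move=> t; rewrite inE => /orP[/eqP->|/zX zt]; rewrite sval_meet; split=> //.
  - exact: sval_joinr.
  - by move/carrier_leP: zy; apply.
  - exact: sval_joinl.
have [X [Xy gX]] := finite_generation y.
have [z hz [xz zy zX]] := key X (fun s sX => asboolT (Xy s sX)).
suff <- : z = y by [].
by apply/le_anti; rewrite zy; apply/carrier_leP; apply: gX (carrier_closed _) zX.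
Qed.

Lemma con_classification x y : (x <= y)%O -> x <> y ->
  exists p c (v : valid (Lo p c)), con x y = con (lo v) (hi v).
Proof.
move=> xy nxy; have hth := con_congruence x y; have hxy := @con_collapses _ _ x y.
have hx := carrier_closed x.
have key (X : seq (pt P)) : {subset X <= [pred s | `[< sval y s >]]} ->
    (forall s, s \in X -> sval x s) \/ exists p c (v : valid (Lo p c)),
    [/\ split_interval (sval x) p c, con x y (lo v, hi v) &
       forall s, s \in X -> collapse p (sval x) s].
  elim: X => [|s X IH] hX; first by left.
  have ys : sval y s by apply/asboolP; apply: (hX s); rewrite inE eqxx.
  have {IH}IH := IH (fun t tX => hX t (mem_behead (s := s :: X) tX)).
  have [xs|nxs] := pselect (sval x s).
    case: IH => [h|[p [c [v [h1 h2 h3]]]]].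
      by left=> t; rewrite inE => /orP[/eqP->//|/h].
    right; exists p, c, v; split=> // t; rewrite inE => /orP[/eqP->|/h3//].
    exact: sub_collapse.
  have [q [e [w [g1 g2 g3]]]] := separating_interval hth hxy xy ys nxs.
  right; case: IH => [h|[p [c [v [h1 h2 h3]]]]].
    exists q, e, w; split=> // t; rewrite inE => /orP[/eqP->//|/h xt].
    exact: sub_collapse.
  (* Both intervals are split by [x], so their colours are comparable; the larger colour also covers
     the points handled by the smaller. *)
  have [pq|qp] := split_interval_total hx h1 g1.
    exists q, e, w; split=> // t; rewrite inE => /orP[/eqP->//|/h3].
    exact: collapse_le.
  exists p, c, v; split=> // t; rewrite inE => /orP[/eqP->|/h3//].
  exact: collapse_le qp _ g3.
have [s ys nxs] : exists2 s, sval y s & ~ sval x s.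
  apply: contrapT => n; apply: nxy; apply/le_anti; rewrite xy.
  apply/carrier_leP => s ys; apply: contrapT => nx; apply: n; by exists s.
have [X [Xy gX]] := finite_generation y.
have [h|[p [c [v [h1 h2 h3]]]]] := key X (fun s sX => asboolT (Xy s sX)).
  by case: nxs; apply: gX hx h _ ys.
exists p, c, v; apply/seteqP; split; last exact: con_least.
apply: con_least; first exact: con_congruence.
apply: con_of_collapse xy _.
exact: gX (collapse_closed p hx) h3.
Qed.

(** * The isomorphism and countability *)

Lemma kap_valid p : p <> bot F -> valid (Lo p (kap F p)).
Proof. by move=> p0; split=> //=; [exact: kap_lev|exact: kap_ge]. Qed.

(** A fixed element, so that [con base base] names the least congruence, the image of zero. *)
Let base : carrier := lo (lev_valid (kap_lev F (bot F))).1.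

Definition princ_con p : set (carrier * carrier) :=
  if pselect (p <> bot F) is left p0
  then con (lo (kap_valid p0)) (hi (kap_valid p0)) else con base base.

Lemma princ_con_le p q : p <= q <-> princ_con p `<=` princ_con q.
Proof.
rewrite /princ_con.
case: pselect => [p0|/contrapT ->]; last first.
  split=> // _; last exact: bot_le.
  by apply: con_refl_sub; case: pselect => *; apply: con_congruence.
case: pselect => [q0|/contrapT ->]; first by rewrite con_interval_le.
split=> h; first by case: p0; apply/le_anti; rewrite h bot_le.
rewrite -(collapse_cong_interval _ (kap_valid p0)).
apply: (con_refl_sub (x := base) (collapse_congP _)); apply: h.
exact: con_collapses.
Qed.

Lemma iso_carrier : iso_Princ P carrier.
Proof.
exists princ_con; last exact: princ_con_le.
split.
- by move=> p _ /=; rewrite /princ_con; case: pselect => h; eexists; eexists.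
- move=> p q _ _ E; apply/le_anti/andP.
  by split; apply/princ_con_le; rewrite E.
- move=> _ [x [y ->]].
  rewrite con_meet_join.
  have [E|nE] := pselect ((x `&` y)%O = (x `|` y)%O).
    exists (bot F) => //; rewrite E /princ_con; case: pselect => // _.
    by apply/seteqP; split; apply: con_refl_sub; apply: con_congruence.
  have [p [c [v ->]]] := con_classification (le_trans (leIl x y) (leUl x y)) nE.
  have [_ p0 _] := v.
  exists p => //; rewrite /princ_con; case: pselect => // p0'.
  by apply/seteqP; split; apply/con_interval_le.
Qed.

Lemma countable_carrier : countable [set: P] -> countable [set: carrier].
Proof.
move=> /countable_injP[g /in2TT gI]; apply/countable_injP.
pose code s := pickle (match s with
  | Lo p c => (0, g p, g c, None) | Hi p c => (1, g p, g c, None)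
  | Dum c i => (2, g c, 0, i) end)%N.
have codeI : injective code.
  move=> s t /(pcan_inj pickleK_inv).
  by case: s t => [p c|p c|c i] [q e|q e|e j] // [] => [/gI-> /gI->|/gI-> /gI->|/gI-> ->].
(* A chosen finite generating list determines the element, so its code is injective. *)
have [X hX] := choice finite_generation.
exists (fun x => pickle (map code (X x))) => x y _ _.
move=> /(pcan_inj pickleK_inv)/(inj_map codeI) E.
have [Xx gx] := hX x; have [Xy gy] := hX y.
apply/le_anti/andP; split; apply/carrier_leP.
  by apply: gx (carrier_closed _) _; rewrite E.
by apply: gy (carrier_closed _) _; rewrite -E.
Qed.

Lemma carrier_nonempty : [set: carrier] !=set0.
Proof. by exists base. Qed.

End Points.

(** * From cofinal subsets and chains of ideals to lattices *)

Lemma frame_of_cofinal d (P : porderType d) (D : set P) : has_zero P ->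
    (exists p q : P, p <> q) -> (forall p, exists2 c, D c & p <= c) ->
    (forall E, E `<=` D -> E !=set0 -> exists2 m, E m & forall e, E e -> m <= e) ->
  inhabited (frame P).
Proof.
move=> [z z_min] [p1 [p2 p12]] cof minD.
pose D' c := D c /\ c <> z.
have minD' (E : set P) : E `<=` D' -> E !=set0 ->
    exists2 m, E m & forall e, E e -> m <= e.
  by move=> sub; apply: minD => c /sub[].
have [a az] : exists a, a <> z.
  apply: contrapT => n; apply: p12; transitivity z; last apply: esym;
  by apply: contrapT => ?; apply: n; eexists; eassumption.
have cof' p : exists2 c, D' c & p <= c.
  (* Levels must be nonzero: a bound equal to [z] is replaced by a level above the nonzero element
     [a]. *)
  have [c Dc pc] := cof p; have [c0|] := pselect (c = z); last by exists c.
  have [b Db ab] := cof a; exists b.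
    by split=> // b0; apply: az; apply/le_anti; rewrite z_min -b0 ab.
  by apply: le_trans pc _; rewrite c0.
have exne p : [set c | D' c /\ p <= c] !=set0.
  by have [c h1 h2] := cof' p; exists c.
have ex p : exists k, [/\ D' k, p <= k & forall c, D' c -> p <= c -> k <= c].
  have [k [Dk pk] h] := minD' [set c | D' c /\ p <= c] (fun c h => h.1) (exne p).
  by exists k; split=> // c Dc pc; apply: h.
have [k hk] := choice ex.
apply: inhabits; apply: (@Frame _ _ z z_min D' _ minD' k).
- by move=> c [].
- by move=> p; have [] := hk p.
- by move=> p; have [] := hk p.
- by move=> p c; have [_ _] := hk p; apply.
Qed.

Lemma lattice_of_cofinal d (P : porderType d) (D : set P) : has_zero P ->
    (forall p, exists2 c, D c & p <= c) ->
    (forall E, E `<=` D -> E !=set0 -> exists2 m, E m & forall e, E e -> m <= e) ->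
  exists (d' : Order.disp_t) (L : latticeType d'),
    [/\ [set: L] !=set0, countable [set: P] -> countable [set: L] & iso_Princ P L].
Proof.
move=> hz cof minD.
have [two|one] := pselect (exists p q : P, p <> q).
  have [F] := frame_of_cofinal hz two cof minD.
  exists _, (carrier F); split.
  - exact: carrier_nonempty.
  - exact: countable_carrier.
  - exact: iso_carrier.
(* A one-element [P] has no nonzero level and hence no frame; the one-element lattice serves
   instead. *)
have triv (p q : P) : p = q by apply: contrapT => pq; apply: one; exists p, q.
have [z _] := hz.
exists _, (Order.Lattice.clone _ 'I_1 _); split.
- by exists ord0.
- by move=> _; apply: (@countableP _ [set: 'I_1]).
- exists (fun=> con ord0 ord0) => [|p q]; last by rewrite (triv p q); split=> // _ s.
  split.
  + by move=> p _; exists ord0, ord0.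
  + by move=> p q _ _ _; apply: triv.
  + move=> _ [i [j ->]]; exists z => //.
    by rewrite (ord1 i : i = ord0) (ord1 j : j = ord0).
Qed.

(* Well-order P by R and keep the elements of [D0] that dominate all their
   R-predecessors in [D0]: on those, R and the order of P agree. *)
Lemma well_ordered_cofinal d (P : porderType d) (D0 : set P) :
    (forall p, exists2 c, D0 c & p <= c) ->
    (forall c e, D0 c -> D0 e -> c <= e \/ e <= c) ->
  exists D : set P, (forall p, exists2 c, D c & p <= c) /\
    (forall E, E `<=` D -> E !=set0 -> exists2 m, E m & forall e, E e -> m <= e).
Proof.
move=> cof tot; have [R wo] := well_ordering_principle P.
have anti x y : R x y -> R y x -> x = y.
  move=> xy yx; apply: (wo_chain_antisymmetric (withinW wo (A := predT))) => //.
  by rewrite xy yx.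
have minR (E : set P) : E !=set0 -> exists2 m, E m & forall e, E e -> R m e.
  move=> [e0 Ee0]; have [|m [[/asboolP Em h] _]] := wo [pred e | `[< E e >]].
    by exists e0; apply/asboolP.
  by exists m => // e Ee; apply: h; apply/asboolP.
exists [set c | D0 c /\ forall e, D0 e -> R e c -> e <= c]; split.
  move=> p; have [|c [Dc pc] h] := minR [set c | D0 c /\ p <= c].
    by have [c] := cof p; exists c.
  exists c => //; split=> // e De Rec; have [//|ce] := tot e c De Dc.
  suff -> : e = c by [].
  by apply: anti => //; apply: h; split=> //; apply: le_trans pc ce.
move=> E sub /minR[m Em h]; exists m => // e Ee.
by have [_] := sub _ Ee; apply; [case: (sub _ Em)|apply: h].
Qed.

Lemma lattice_of_chain d (P : porderType d) (C : set (set P)) : has_zero P ->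
    is_chain_of_principal_ideals C -> \bigcup_(I in C) I = [set: P] ->
  exists (d' : Order.disp_t) (L : latticeType d'),
    [/\ [set: L] !=set0, countable [set: P] -> countable [set: L] & iso_Princ P L].
Proof.
move=> hz [prin tot] cov.
(* The generators of the ideals form a cofinal chain in [P]. *)
have [] := @well_ordered_cofinal _ P [set c | C [set x | x <= c]].
- move=> p; have [I CI Ip] : (\bigcup_(I in C) I) p by rewrite cov.
  by have [c E] := prin I CI; exists c; move: CI Ip; rewrite E.
- move=> c e Cc Ce; have [h|h] := tot _ _ Cc Ce.
    by left; apply: h => /=.
  by right; apply: h => /=.
- by move=> D [cof minD]; apply: lattice_of_cofinal hz cof minD.
Qed.

Lemma directed_countable_chain d (P : porderType d) : has_zero P ->
    countable [set: P] -> directed P ->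
  exists C : set (set P),
    is_chain_of_principal_ideals C /\ \bigcup_(I in C) I = [set: P].
Proof.
move=> [z _] /countable_injP[g /in2TT gI] dir.
have /choice[ub ubP] (pq : P * P) : exists r, pq.1 <= r /\ pq.2 <= r.
  have [->|] := pselect (pq.1 = pq.2); first by exists pq.2.
  exact: dir.
(* [e] enumerates [P] by inverting [g], with default [z] outside its range. *)
have /choice[e eP] (n : nat) : exists p, forall q, g q = n -> p = q.
  have [[q E]|no] := pselect (exists q, g q = n).
    by exists q => q' E'; apply: gI; rewrite E.
  by exists z => q E; case: no; exists q.
(* Each term bounds the previous one and the next enumerated element, so [p] lies below
   [c (g p).+1]. *)
pose c := fix c n := if n is m.+1 then ub (c m, e m) else z.
have c_mono m n : (m <= n)%N -> c m <= c n.
  move=> /subnK <-; elim: (n - m)%N => [|k IH] //=.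
  by apply: le_trans IH _; have [] := ubP (c (k + m)%N, e (k + m)%N).
exists [set I | exists n, I = [set x | x <= c n]]; split; first split.
- by move=> _ [n ->]; exists (c n).
- move=> _ _ [m ->] [n ->]; have [mn|/ltnW nm] := leqP m n; [left|right] => x /= h;
  by apply: le_trans h _; apply: c_mono.
- apply/seteqP; split=> // p _.
  exists [set x | x <= c (g p).+1]; first by exists (g p).+1.
  by rewrite /= -{1}(eP _ p erefl); have [] := ubP (c (g p), e (g p)).
Qed.

(** * Necessary conditions on Princ(L) *)

Section PrincProperties.
Context {d d' : Order.disp_t} {P : porderType d} {L : latticeType d'}.
Variable f : P -> set (L * L).
Hypotheses (f_bij : set_bij [set: P] (Princ L) f)
  (f_le : forall p q, p <= q <-> f p `<=` f q).

Lemma Princ_has_zero : [set: L] !=set0 -> has_zero P.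
Proof.
have [f_fun _ f_surj] := f_bij; move=> [a _].
have [z _ E] := f_surj (con a a) (ex_intro _ a (ex_intro _ a erefl)).
exists z => p; apply/f_le; rewrite E.
have [u [v ->]] : Princ L (f p) by apply: f_fun.
by apply: con_refl_sub; apply: con_congruence.
Qed.

Lemma Princ_directed : directed P.
Proof.
have [f_fun _ f_surj] := f_bij; move=> p q _.
have [a [b pE]] : Princ L (f p) by apply: f_fun.
have [a' [b' qE]] : Princ L (f q) by apply: f_fun.
pose m := ((a `&` b) `&` (a' `&` b'))%O; pose j := ((a `|` b) `|` (a' `|` b'))%O.
have [r _ rE] := f_surj (con m j) (ex_intro _ m (ex_intro _ j erefl)).
exists r; split; apply/f_le; rewrite rE ?pE ?qE; apply: con_le_con.
- by rewrite (le_trans (leIl _ _)) ?leIl // lexU2 // leUl.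
- by rewrite (le_trans (leIl _ _)) ?leIr // lexU2 // leUr.
- by rewrite (le_trans (leIr _ _)) ?leIl // lexU2 // leUl orbT.
- by rewrite (le_trans (leIr _ _)) ?leIr // lexU2 // leUr orbT.
Qed.

Lemma Princ_countable : countable [set: L] -> countable [set: P].
Proof.
have [f_fun f_inj _] := f_bij; move=> /countable_injP[g /in2TT gI].
have /choice[h hE] (p : P) : exists ab : L * L, f p = con ab.1 ab.2.
  by have [a [b E]] : Princ L (f p) by [apply: f_fun]; exists (a, b).
apply/countable_injP; exists (fun p => pickle (g (h p).1, g (h p).2)) => p q _ _.
move=> /(pcan_inj pickleK_inv)[/gI E1 /gI E2].
by apply: f_inj; rewrite ?inE // !hE E1 E2.
Qed.

End PrincProperties.

Theorem theorem1p1 :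
  (forall (d : Order.disp_t) (P : porderType d), [set: P] !=set0 ->
    ((exists (d' : Order.disp_t) (L : latticeType d'),
        [/\ [set: L] !=set0, countable [set: L] & iso_Princ P L])
     <-> [/\ countable [set: P], directed P & has_zero P])) /\
  (forall (d : Order.disp_t) (P : porderType d), [set: P] !=set0 ->
    has_zero P ->
    (exists C : set (set P),
        is_chain_of_principal_ideals C /\ \bigcup_(I in C) I = [set: P]) ->
    exists (d' : Order.disp_t) (L : latticeType d'),
      [set: L] !=set0 /\ iso_Princ P L).
Proof.
split=> [d P P0|d P P0 hz [C [hC cov]]]; last first.
  have [d' [L [L0 _ iso]]] := lattice_of_chain hz hC cov.
  by exists d', L.
split=> [[d' [L [L0 cL [f f_bij f_le]]]]|[cP dir hz]].
  split; [exact: Princ_countable f_bij cL|exact: Princ_directed f_bij f_le|].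
  exact: Princ_has_zero f_bij f_le L0.
(* Countability and directedness yield a chain of principal ideals, so the construction for (ii)
   applies, and it preserves countability. *)
have [C [hC cov]] := directed_countable_chain hz cP dir.
have [d' [L [L0 cL iso]]] := lattice_of_chain hz hC cov.
by exists d', L; split=> //; apply: cL.
Qed.
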